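(* For every $\lambda>0$, $$\|E_\lambda\|_2=\max_i\frac{\sigma_i(\Phi)}{\sigma_i(\Phi)^2+\lambda}\le\frac{1}{2\sqrt{\lambda}}.$$ Consequently, for all input functions $f,g$ with sampled vectors $\mathbf f,\mathbf g\in\mathbb R^{n_1}$, $$\|\mathbf a_\lambda(f)-\mathbf a_\lambda(g)\|_2\le\frac{1}{2\sqrt{\lambda}}\,\|\mathbf f-\mathbf g\|_2 .$$
   Context: Let $\varphi_1,\dots,\varphi_{m_1}$ be fixed real-valued basis functions on a domain and $\mathbf x_1,\dots,\mathbf x_{n_1}$ observation points in that domain. Let $\Phi\in\mathbb R^{n_1\times m_1}$ be the matrix with entries $\Phi_{ij}=\varphi_j(\mathbf x_i)$, and let $\sigma_i(\Phi)$, $1\le i\le\min(n_1,m_1)$, denote its singular values. For a real-valued input function $f$, its sampled vector is $\mathbf f=(f(\mathbf x_1),\dots,f(\mathbf x_{n_1}))^\top\in\mathbb R^{n_1}$ (similarly $\mathbf g$ for $g$). For $\lambda>0$ the regularized coefficient encoder is $$\mathbf a_\lambda(f)=\arg\min_{\mathbf a\in\mathbb R^{m_1}}\left\{\|\Phi\mathbf a-\mathbf f\|_2^2+\lambda\|\mathbf a\|_2^2\right\},$$ equivalently $\mathbf a_\lambda(f)=E_\lambda\mathbf f$ with $E_\lambda=(\Phi^\top\Phi+\lambda I)^{-1}\Phi^\top\in\mathbb R^{m_1\times n_1}$. For matrices, $\|\cdot\|_2$ is the spectral (operator) norm; for vectors it is the Euclidean norm. *)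

(* Defs.v *)
From mathcomp Require Import all_boot all_order all_algebra.
From mathcomp Require Import boolp classical_sets reals.
From mathcomp Require Import complex ring.
Set Implicit Arguments.
Unset Strict Implicit.
Unset Printing Implicit Defensive.
Import Order.TTheory GRing.Theory Num.Theory.
Local Open Scope classical_set_scope.
Local Open Scope ring_scope.

(* MathComp-Analysis norms matrices by the sup norm, hence these two norms. *)
Definition l2norm (R : realType) n (v : 'cV[R]_n) : R :=
  Num.sqrt (\sum_i v i 0 ^+ 2).

Definition opnorm (R : realType) m n (A : 'M[R]_(m, n)) : R :=
  sup [set l2norm (A *m v) | v in [set v : 'cV[R]_n | l2norm v <= 1]].

(* Eigenvalues of A^T A with multiplicity, in nonincreasing order. The library
   diagonalises hermitian matrices over R[i] (spectral_diag A is the diagonal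
   of a unitary diagonalisation of A), so A^T A is first embedded there; its
   eigenvalues are real. *)
Definition gram_eigenvalues (R : realType) m n (A : 'M[R]_(m, n)) : seq R :=
  let d := spectral_diag (map_mx (real_complex R) (A^T *m A)) in
  sort (fun s t : R => t <= s) [seq complex.Re (d 0 j) | j : 'I_n].

(* The i-th largest singular value. When m < n, the n - m smallest eigenvalues
   of A^T A, which vanish, are left out. *)
Definition singular_value (R : realType) m n (A : 'M[R]_(m, n))
    (i : 'I_(minn m n)) : R :=
  Num.sqrt (gram_eigenvalues A)`_i.

Section Encoder.
Context {R : realType} {T : Type} {n m : nat}.
Variables (phi : 'I_m -> T -> R) (x : 'I_n -> T) (lambda : R).

Definition sample (f : T -> R) : 'cV[R]_n := \col_i f (x i).

Definition design_mx : 'M[R]_(n, m) := \matrix_(i, j) phi j (x i).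

Definition encoder_mx : 'M[R]_(m, n) :=
  invmx (design_mx^T *m design_mx + lambda%:M) *m design_mx^T.

Definition ridge (f : T -> R) (a : 'cV[R]_m) : R :=
  l2norm (design_mx *m a - sample f) ^+ 2 + lambda * l2norm a ^+ 2.

Definition ridge_argmin (f : T -> R) : set 'cV[R]_m :=
  [set a | forall b, ridge f a <= ridge f b].

(* For lambda > 0 the argmin is a singleton: see ridge_argminE. *)
Definition encoder (f : T -> R) : 'cV[R]_m := xget 0 (ridge_argmin f).

Let dot k (u v : 'cV[R]_k) : R := (u^T *m v) 0 0.

Lemma l2norm_sqr k (v : 'cV[R]_k) : l2norm v ^+ 2 = (v^T *m v) 0 0.
Proof.
rewrite /l2norm sqr_sqrtr; last by apply: sumr_ge0 => i _; exact: sqr_ge0.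
by rewrite mxE; apply: eq_bigr => i _; rewrite mxE expr2.
Qed.

Lemma l2norm_eq0 k (v : 'cV[R]_k) : l2norm v = 0 -> v = 0.
Proof.
move=> /eqP; rewrite sqrtr_eq0 => v_le0.
have /psumr_eq0P v0 : \sum_i v i 0 ^+ 2 = 0.
  by apply/le_anti; rewrite v_le0 sumr_ge0// => i _; exact: sqr_ge0.
apply/colP => i; rewrite mxE; apply/eqP; rewrite -sqrf_eq0.
by apply/eqP/v0 => // j _; exact: sqr_ge0.
Qed.

Hypothesis lambda_gt0 : 0 < lambda.

Lemma gram_unit : design_mx^T *m design_mx + lambda%:M \in unitmx.
Proof.
set A := _ + _.
rewrite -row_free_unit -kermx_eq0; apply/rowV0P => v /sub_kermxP vA0.
apply/trmx_inj; rewrite trmx0; apply: l2norm_eq0.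
have e : l2norm (design_mx *m v^T) ^+ 2 + lambda * l2norm v^T ^+ 2 = 0.
  have : (v *m A *m v^T) 0 0 = 0 by rewrite vA0 mul0mx mxE.
  rewrite mulmxDr mulmxDl mul_mx_scalar -scalemxAl => <-.
  by rewrite !l2norm_sqr trmx_mul trmxK !mulmxA !mxE.
move/eqP: e; rewrite paddr_eq0 ?sqr_ge0 ?(mulr_ge0 (ltW lambda_gt0) (sqr_ge0 _))//.
by move=> /andP[_]; rewrite mulf_eq0 gt_eqF//= sqrf_eq0 => /eqP.
Qed.

Lemma ridge_decomp f b : let a := encoder_mx *m sample f in
  ridge f b = ridge f a
    + (l2norm (design_mx *m (b - a)) ^+ 2 + lambda * l2norm (b - a) ^+ 2).
Proof.
move=> a; set P := design_mx; set d := b - a; set r := P *m a - sample f.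
have normal_eq : P^T *m r + lambda *: a = 0.
  have : (P^T *m P + lambda%:M) *m a = P^T *m sample f.
    by rewrite /a /encoder_mx !mulmxA mulmxV ?mul1mx// gram_unit.
  rewrite mulmxDl mul_scalar_mx => e.
  by rewrite /r mulmxBr addrAC mulmxA e subrr.
have sqD k (u v : 'cV[R]_k) :
    l2norm (u + v) ^+ 2 = l2norm u ^+ 2 + 2 * dot u v + l2norm v ^+ 2.
  have dotC : dot v u = dot u v.
    by rewrite /dot -[v^T *m u]trmxK trmx_mul trmxK mxE.
  have addE (M N : 'M[R]_1) : (M + N) 0 0 = M 0 0 + N 0 0 by rewrite mxE.
  rewrite !l2norm_sqr [(u + v)^T]linearD/= mulmxDr !mulmxDl !addE.
  by rewrite -!/(dot _ _) dotC mulr_natl mulr2n !addrA.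
have cross : dot r (P *m d) + lambda * dot a d = 0.
  have : ((P^T *m r + lambda *: a)^T *m d) 0 0 = 0.
    by rewrite normal_eq trmx0 mul0mx mxE.
  rewrite [(_ + _)^T]linearD/= [(lambda *: a)^T]linearZ/= trmx_mul trmxK.
  by rewrite mulmxDl -scalemxAl -mulmxA mxE [X in _ + X]mxE.
rewrite /ridge -/P -/r.
have -> : P *m b - sample f = r + P *m d.
  by rewrite /d mulmxBr /r [RHS]addrC addrA subrK.
have -> : b = a + d by rewrite [RHS]addrC subrK.
have crossE : dot r (P *m d) = - (lambda * dot a d).
  by apply/eqP; rewrite -addr_eq0 cross.
rewrite (sqD _ r) (sqD _ a) crossE.
move: (l2norm r) (l2norm a) (l2norm d) (l2norm (P *m d)) (dot a d) => *; ring.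
Qed.

Lemma ridge_argminE f : ridge_argmin f = [set encoder_mx *m sample f].
Proof.
apply/seteqP; split => [b /= /(_ (encoder_mx *m sample f))|_ -> b /=].
  rewrite [ridge f b]ridge_decomp gerDl => le0.
  set d := b - _ in le0 *.
  have : lambda * l2norm d ^+ 2 <= 0.
    by apply: le_trans le0; rewrite lerDr sqr_ge0.
  rewrite pmulr_rle0// => d2_le0; apply/subr0_eq/l2norm_eq0/eqP.
  by rewrite -sqrf_eq0 eq_le d2_le0 sqr_ge0.
rewrite [ridge f b]ridge_decomp lerDl addr_ge0 ?sqr_ge0//.
by rewrite mulr_ge0 ?sqr_ge0// ltW.
Qed.

Lemma encoderE f : encoder f = encoder_mx *m sample f.
Proof. by rewrite /encoder ridge_argminE; apply: xget_unique. Qed.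

End Encoder.

(* Main.v *)
Require Import Defs.
From mathcomp Require Import all_boot all_order all_algebra.
From mathcomp Require Import boolp classical_sets reals complex ring lra.
Import Order.TTheory GRing.Theory Num.Theory.
Local Open Scope ring_scope.
Set Implicit Arguments.
Unset Strict Implicit.
Unset Printing Implicit Defensive.

(** Write [A] for the design matrix, [G = A^T A], [K = G + lambda] and
    [E = K^-1 A^T].  An orthonormal eigenbasis of [G] turns the claim into one
    about the scalars [sqrt d / (d + lambda)], [d] an eigenvalue of [G]; let [M]
    be the largest of these.

    Upper bound.  A matrix and its transpose admit the same operator bounds
    ([l2norm_trmx_bound], from Cauchy-Schwarz), so it suffices to bound
    [E^T = A K^-1], that is, to prove [|A u| <= M |K u|] for all [u].  With [c]
    the coordinates of [u] in the eigenbasis this reads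
    [sum d_j c_j^2 <= M^2 sum (d_j + lambda)^2 c_j^2], which holds term by term
    by the choice of [M] ([l2norm_gram_shift], [spectrum_le_gain]).

    Lower bound.  If [G u = d u] then [E] maps [A u] to [d / (d + lambda) u],
    while [|A u| = sqrt d |u|]; the ratio of the norms is the scalar attached to
    [d] ([gain_le_opnorm]).

    Two points need care.  The diagonalisation of [G] is given over [R[i]] by a
    unitary matrix [P].  Stacking the real and imaginary parts of [P] gives a
    real isometry from [R^n] to [R^(n + n)] which still intertwines [G] with a
    diagonal matrix, each eigenvalue now being listed twice ([gram_frame]); for
    sums of squares this is as good as a real orthonormal eigenbasis.  Also,
    singular values come only from the [minn m n] largest eigenvalues, so it has
    to be checked that no positive eigenvalue is lost: there are at most
    [rank A <= m] of them ([card_gram_spectrum_gt0]), and they come first in the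
    nonincreasing enumeration ([spectrum_singular_value]).

    The bound [M <= 1 / (2 sqrt lambda)] is [2 s t <= s^2 + t^2] at
    [t = sqrt lambda], and the Lipschitz estimate follows since the encoder is
    the linear map [E] applied to the sample. *)

(** * Euclidean and operator norms *)

Section Euclidean.
Context {R : realType}.

Lemma l2norm_ge0 n (v : 'cV[R]_n) : 0 <= l2norm v.
Proof. exact: sqrtr_ge0. Qed.

Lemma l2norm0 n : l2norm (0 : 'cV[R]_n) = 0.
Proof. by apply/eqP; rewrite -sqrf_eq0 l2norm_sqr mulmx0 mxE. Qed.

Lemma l2normZ n k (v : 'cV[R]_n) : l2norm (k *: v) = `|k| * l2norm v.
Proof.
rewrite /l2norm -sqrtr_sqr -sqrtrM ?sqr_ge0// mulr_sumr; congr Num.sqrt.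
by apply: eq_bigr => i _; rewrite mxE exprMn.
Qed.

Lemma l2norm_gt0 n (v : 'cV[R]_n) : v != 0 -> 0 < l2norm v.
Proof.
rewrite lt_def l2norm_ge0 andbT; apply: contra_neq; exact: l2norm_eq0.
Qed.

(** Cauchy-Schwarz, by expanding the square of [| |v| u - |u| v |]. *)
Lemma dot_le_l2norm n (u v : 'cV[R]_n) :
  (u^T *m v) 0 0 <= l2norm u * l2norm v.
Proof.
have [->|/l2norm_gt0 u0] := eqVneq u 0.
  by rewrite trmx0 mul0mx mxE mulr_ge0 ?l2norm_ge0.
have [->|/l2norm_gt0 v0] := eqVneq v 0.
  by rewrite mulmx0 mxE mulr_ge0 ?l2norm_ge0.
set a := l2norm u in u0 *; set b := l2norm v in v0 *.
have : 0 <= l2norm (b *: u - a *: v) ^+ 2 by rewrite sqr_ge0.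
rewrite l2norm_sqr.
have -> : ((b *: u - a *: v)^T *m (b *: u - a *: v)) 0 0 =
   b ^+ 2 * (u^T *m u) 0 0 - 2 * a * b * (u^T *m v) 0 0
   + a ^+ 2 * (v^T *m v) 0 0.
  rewrite !mxE !mulr_sumr -sumrB -big_split/=; apply: eq_bigr => i _.
  by rewrite !mxE; ring.
rewrite -!l2norm_sqr -/a -/b => h.
by rewrite -(ler_pM2l (mulr_gt0 u0 v0)); lra.
Qed.

(** The supremum that defines [opnorm] is only meaningful for a set that is
    bounded above; any bound [M] for [A] provides that. *)
Lemma le_opnorm m n (A : 'M[R]_(m, n)) (M : R) (v : 'cV[R]_n) :
  (forall w, l2norm (A *m w) <= M * l2norm w) -> 0 <= M ->
  l2norm (A *m v) <= opnorm A * l2norm v.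
Proof.
move=> leM M0; have [->|/l2norm_gt0 v0] := eqVneq v 0.
  by rewrite mulmx0 !l2norm0 mulr0.
rewrite -ler_pdivrMr// mulrC; set k := (l2norm v)^-1.
have k0 : 0 < k by rewrite invr_gt0.
have -> : k * l2norm (A *m v) = l2norm (A *m (k *: v)).
  by rewrite -scalemxAr l2normZ gtr0_norm.
apply: ub_le_sup; last first.
  by exists (k *: v) => //=; rewrite l2normZ gtr0_norm// mulVf ?gt_eqF.
exists M => _ [w /= w1 <-]; apply: (le_trans (leM w)).
by rewrite -[leRHS]mulr1 ler_wpM2l.
Qed.

Lemma opnorm_ge0 m n (A : 'M[R]_(m, n)) : 0 <= opnorm A.
Proof.
rewrite /opnorm; set S := (X in sup X).
(* The supremum of a set without least upper bound is 0 by convention. *)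
have [/sup_upper_bound ubS|/sup_out-> //] := pselect (has_sup S).
by apply: ubS; exists 0; rewrite ?mulmx0 /= l2norm0.
Qed.

Lemma opnorm_le m n (A : 'M[R]_(m, n)) (M : R) :
  (forall w, l2norm (A *m w) <= M * l2norm w) -> 0 <= M -> opnorm A <= M.
Proof.
move=> leM M0; apply: ge_sup.
  by exists (l2norm (A *m 0)), 0 => //=; rewrite l2norm0.
move=> _ [w /= w1 <-]; apply: (le_trans (leM w)).
by rewrite -[leRHS]mulr1 ler_wpM2l.
Qed.

(** [|A v|^2] is the inner product of [v] and [A^T (A v)], hence at most
    [|v| M |A v|]; then divide by [|A v|]. *)
Lemma l2norm_trmx_bound m n (A : 'M[R]_(m, n)) (M : R) : 0 <= M ->
  (forall w, l2norm (A^T *m w) <= M * l2norm w) ->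
  forall v, l2norm (A *m v) <= M * l2norm v.
Proof.
move=> M0 leM v; have [Av0|/l2norm_gt0 Av0] := eqVneq (A *m v) 0.
  by rewrite Av0 l2norm0 mulr_ge0 ?l2norm_ge0.
rewrite -(ler_pM2r Av0) -expr2 l2norm_sqr.
have -> : (A *m v)^T *m (A *m v) = v^T *m (A^T *m (A *m v)).
  by rewrite trmx_mul !mulmxA.
apply: le_trans (dot_le_l2norm _ _) _.
by rewrite mulrAC [leRHS]mulrC ler_wpM2l ?l2norm_ge0.
Qed.

End Euclidean.

(** * The spectrum of a Gram matrix *)

(** Taking real or imaginary parts preserves a relation [P B = D P] with [B] and
    [D] real, because both are real-linear. *)
Lemma map_diagonalised {R : realType} n (f : R[i] -> R)
    (P : 'M[R[i]]_n) (B : 'M[R]_n) (D : 'rV[R]_n) :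
    f 0 = 0 -> {morph f : x y / x + y} ->
    (forall z k, f (z * real_complex R k) = f z * k) ->
  P *m map_mx (real_complex R) B = diag_mx (map_mx (real_complex R) D) *m P ->
  map_mx f P *m B = diag_mx D *m map_mx f P.
Proof.
move=> f0 fD fR e; apply/matrixP => i j.
have /matrixP/(_ i j)/(congr1 f) := e; rewrite !mul_diag_mx !mxE.
rewrite mulrC fR (big_morph f fD f0) [RHS]mulrC => <-.
by apply: eq_bigr => k _; rewrite !mxE fR.
Qed.

Section GramSpectrum.
Context {R : realType} {m n : nat}.
Variable A : 'M[R]_(m, n).
Local Notation toC := (real_complex R).
Local Notation G := (A^T *m A).
Local Notation GC := (map_mx toC G).
Local Notation P := (spectralmx GC).

Definition gram_spectrum : 'rV[R]_n :=
  map_mx (@complex.Re R) (spectral_diag GC).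
Local Notation d := gram_spectrum.

Lemma toC_real (z : R) : toC z \is Num.real.
Proof. exact/CrealP/conjc_real. Qed.

Lemma gramC_herm : GC \is hermsymmx.
Proof.
apply: realsym_hermsym.
  apply/is_hermitianmxP; rewrite expr0 scale1r map_mx_id //.
  by rewrite map_trmx trmx_mul trmxK.
by apply/mxOverP => i j; rewrite mxE toC_real.
Qed.

Lemma gram_spectrumC : map_mx toC d = spectral_diag GC.
Proof.
apply/rowP => j; rewrite !mxE.
have /mxOverP/(_ 0 j) := hermitian_spectral_diag_real gramC_herm.
by move=> /RRe_real.
Qed.

Lemma gram_diagonalised : P *m GC = diag_mx (map_mx toC d) *m P.
Proof.
have /hermitian_normalmx/orthomx_spectralP e := gramC_herm.
rewrite [X in _ *m X]e gram_spectrumC.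
by rewrite !mulmxA mulmxV ?spectral_unit// mul1mx.
Qed.

Lemma row_spectralmx_gram j : row j P *m GC = toC (d 0 j) *: row j P.
Proof.
by rewrite -row_mul gram_diagonalised row_mul row_diag_mx -scalemxAl -rowE mxE.
Qed.

(** A complex eigenvector exists (a row of [P]).  Having a given real number as
    an eigenvalue is a rank condition, so a real eigenvector exists too. *)
Lemma gram_eigenvector j : exists2 u : 'cV[R]_n, u != 0 & G *m u = d 0 j *: u.
Proof.
have : eigenvalue GC (toC (d 0 j)).
  apply/eigenvalueP; exists (row j P); first exact: row_spectralmx_gram.
  have /row_free_inj inj : row_free P by rewrite row_free_unit spectral_unit.
  apply/eqP => P0; have : delta_mx 0 j *m P = 0 *m P :> 'rV_n.
    by rewrite -rowE P0 mul0mx.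
  move=> /inj /matrixP/(_ 0 j); rewrite !mxE !eqxx => /eqP.
  by rewrite oner_eq0.
rewrite eigenvalue_map => /eigenvalueP [v vG v0].
exists v^T; first by rewrite trmx_eq0.
by rewrite -linearZ/= -vG [RHS]trmx_mul trmx_mul trmxK.
Qed.

Lemma l2norm_gram_eigenvector k (u : 'cV[R]_n) :
  G *m u = k *: u -> l2norm (A *m u) ^+ 2 = k * l2norm u ^+ 2.
Proof.
move=> Gu; rewrite !l2norm_sqr trmx_mul -mulmxA [A^T *m _]mulmxA Gu.
by rewrite -scalemxAr mxE.
Qed.

Lemma gram_spectrum_ge0 j : 0 <= d 0 j.
Proof.
have [u /l2norm_gt0 u0 /l2norm_gram_eigenvector e] := gram_eigenvector j.
by rewrite -(pmulr_lge0 _ (exprn_gt0 2 u0)) -e sqr_ge0.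
Qed.

(** The rows of [P] attached to positive eigenvalues are orthonormal, hence
    independent, and each is a multiple of its image under [G], hence lies in
    the row space of [A]. *)
Lemma card_gram_spectrum_gt0 : (#|[set j | 0 < d 0 j]%R| <= m)%N.
Proof.
set S := [set j | _].
pose f (i : 'I_#|S|) : 'I_n := enum_val i.
have rank_f : \rank (rowsub f P) = #|S|.
  apply: mxrank_unitary; apply/unitarymxP; apply/matrixP => i j.
  have /unitarymxP/matrixP/(_ (f i) (f j)) := spectral_unitarymx GC.
  rewrite !mxE (inj_eq enum_val_inj) => <-.
  by apply: eq_bigr => k _; rewrite !mxE.
rewrite -rank_f; apply: leq_trans (rank_leq_row A).
rewrite -[leqRHS](mxrank_map toC).
apply: mxrankS; apply/row_subP => i; rewrite row_rowsub.
have di : toC (d 0 (f i)) != 0.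
  have := enum_valP i; rewrite inE -/(f i) fmorph_eq0.
  by case: ltgtP.
have /esym/(canRL (scalerK di)) -> := row_spectralmx_gram (f i).
by rewrite map_mxM mulmxA scalemxAl submxMl.
Qed.

Lemma gram_eigenvaluesE :
  gram_eigenvalues A = sort (fun s t => t <= s) [seq d 0 j | j : 'I_n].
Proof.
by rewrite /gram_eigenvalues; congr sort; apply: eq_map => j; rewrite mxE.
Qed.

Lemma size_gram_eigenvalues : size (gram_eigenvalues A) = n.
Proof. by rewrite gram_eigenvaluesE size_sort size_map -cardT card_ord. Qed.

Lemma singular_value_spectrum (i : 'I_(minn m n)) :
  exists j, singular_value A i = Num.sqrt (d 0 j).
Proof.
have lt_i : (i < size (gram_eigenvalues A))%N.
  by rewrite size_gram_eigenvalues (leq_trans (ltn_ord i)) ?geq_minr.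
have := mem_nth 0 lt_i.
rewrite {2}gram_eigenvaluesE mem_sort => /mapP[j _ e].
by exists j; rewrite /singular_value e.
Qed.

(** If a positive eigenvalue first occurs at position [k] of the nonincreasing
    enumeration, then the entries at [0, ..., k] are all positive, so [k < m] by
    [card_gram_spectrum_gt0]. *)
Lemma spectrum_singular_value j : 0 < d 0 j ->
  exists i : 'I_(minn m n), singular_value A i = Num.sqrt (d 0 j).
Proof.
move=> dj_gt0; set s := gram_eigenvalues A.
have dj_s : d 0 j \in s.
  by rewrite /s gram_eigenvaluesE mem_sort map_f// mem_enum.
pose k := index (d 0 j) s.
have k_lt : (k < size s)%N by rewrite index_mem.
have sk : s`_k = d 0 j by rewrite nth_index.
have s_sorted : sorted (fun s t : R => t <= s) s.
  by apply: sort_sorted => a b; exact: le_total.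
have count_s : (count (fun t => 0 < t)%R s <= m)%N.
  rewrite /s gram_eigenvaluesE (permP (permEl (perm_sort _ _))) count_map.
  apply: leq_trans card_gram_spectrum_gt0.
  rewrite cardE [in leqRHS]/enum_mem size_filter enumT.
  by apply/eq_leq/eq_count => l; rewrite /= inE.
have k_m : (k < m)%N.
  apply: leq_trans count_s; rewrite -[in leqRHS](cat_take_drop k.+1 s).
  rewrite count_cat; apply: leq_trans (leq_addr _ _).
  suff : all (fun t => 0 < t) (take k.+1 s).
    by rewrite all_count size_takel// => /eqP ->.
  apply/(all_nthP 0) => l; rewrite size_takel// => l_k.
  rewrite nth_take// (lt_le_trans dj_gt0)// -sk.
  apply: (sorted_leq_nth _ _ 0 s_sorted) => //.
  - by move=> a b c ba cb; apply: le_trans ba.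
  - by rewrite inE (leq_ltn_trans _ k_lt).
have k_mn : (k < minn m n)%N by rewrite leq_min k_m -size_gram_eigenvalues.
by exists (Ordinal k_mn); rewrite /singular_value /= -/s sk.
Qed.

(** A unitary [P] on [C^n = R^(n + n)], restricted to real vectors, is a real
    isometry: the real part of [P^* P = 1] says that the stacked real and
    imaginary parts of [P] have orthonormal columns. *)
Lemma gram_frame : exists Q : 'M[R]_(n + n, n),
  Q^T *m Q = 1%:M /\ Q *m G = diag_mx (row_mx d d) *m Q.
Proof.
have ReS (F : 'I_n -> R[i]) :
    complex.Re (\sum_k F k) = \sum_k complex.Re (F k).
  by apply: (big_morph (@complex.Re R)) => // -[a b] [c e].
exists (col_mx (map_mx (@complex.Re R) P) (map_mx (@complex.Im R) P)); split.
  have := spectral_unitarymx GC; rewrite -trmxC_unitary => /unitarymxP PP.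
  rewrite tr_col_mx mul_row_col; apply/matrixP => i j.
  have /matrixP/(_ i j)/(congr1 (@complex.Re R)) := PP.
  rewrite !mxE ReS -big_split/= => e.
  transitivity (complex.Re ((i == j)%:R : R[i])); last by case: (i == j).
  rewrite -e; apply: eq_bigr => k _; rewrite !mxE conjCK.
  by case: (P k i) (P k j) => [a b] [c f] /=; rewrite mulNr opprK.
rewrite mul_col_mx diag_mx_row mul_block_col !mul0mx addr0 add0r.
congr col_mx.
  apply: (map_diagonalised (f := @complex.Re R)) gram_diagonalised => //.
    by case=> a b [c e].
  by case=> a b k /=; rewrite mulr0 subr0.
apply: (map_diagonalised (f := @complex.Im R)) gram_diagonalised => //.
  by case=> a b [c e].
by case=> a b k /=; rewrite mulr0 add0r.
Qed.

(** In the coordinates given by [gram_frame] both sides become weighted sums of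
    the same squares, and the hypothesis compares the weights. *)
Lemma l2norm_gram_shift (l M : R) : 0 <= M ->
  (forall j, d 0 j <= M ^+ 2 * (d 0 j + l) ^+ 2) ->
  forall u, l2norm (A *m u) <= M * l2norm ((G + l%:M) *m u).
Proof.
move=> M0 dM u; have [Q [QQ QG]] := gram_frame.
set D := row_mx d d in QG.
have DM k : D 0 k <= M ^+ 2 * (D 0 k + l) ^+ 2.
  by rewrite /D mxE; case: splitP.
clearbody D.
have isoQ w : l2norm w ^+ 2 = l2norm (Q *m w) ^+ 2.
  by rewrite !l2norm_sqr trmx_mul mulmxA -[_ *m Q]mulmxA QQ mulmx1.
rewrite -ler_sqr ?nnegrE ?mulr_ge0 ?l2norm_ge0// exprMn isoQ.
have -> : Q *m ((G + l%:M) *m u) = (diag_mx D + l%:M) *m (Q *m u).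
  rewrite !mulmxDl mulmxDr [diag_mx D *m _]mulmxA -QG !mul_scalar_mx.
  by rewrite -scalemxAr mulmxA.
have -> : l2norm (A *m u) ^+ 2 = ((Q *m u)^T *m (diag_mx D *m (Q *m u))) 0 0.
  rewrite [diag_mx D *m _]mulmxA -QG trmx_mul -!mulmxA [Q^T *m _]mulmxA.
  by rewrite QQ mul1mx l2norm_sqr trmx_mul -!mulmxA.
rewrite l2norm_sqr mulmxDl mul_scalar_mx !mxE mulr_sumr; apply: ler_sum => k _.
rewrite mul_diag_mx !mxE; move: (DM k) (\sum_j _) => h c.
have -> : c * (D 0 k * c) = D 0 k * c ^+ 2 by ring.
have -> : M ^+ 2 * ((D 0 k * c + l * c) * (D 0 k * c + l * c)) =
  M ^+ 2 * (D 0 k + l) ^+ 2 * c ^+ 2 by ring.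
by rewrite ler_wpM2r ?sqr_ge0.
Qed.

End GramSpectrum.

(** * The norm of the ridge encoder *)

Section Ridge.
Context {R : realType} {m n : nat}.
Variables (A : 'M[R]_(m, n)) (l : R).
Hypothesis l_gt0 : 0 < l.
Local Notation G := (A^T *m A).
Local Notation E := (invmx (G + l%:M) *m A^T).
Local Notation gain :=
  (fun i => singular_value A i / (singular_value A i ^+ 2 + l)).
Local Notation M := (\big[Num.max/0]_(i < minn m n) gain i).

Lemma ridge_gram_unit : G + l%:M \in unitmx.
Proof.
have -> : A = design_mx (fun j i => A i j) id.
  by apply/matrixP => i j; rewrite mxE.
exact: gram_unit.
Qed.

Lemma max_gain_ge0 : 0 <= M.
Proof. by have /bigmax_leP[] := lexx M. Qed.

(** For [d > 0] this is the square of [sqrt d / (d + l) <= M], as [sqrt d] is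
    then a singular value; for [d = 0] the left-hand side vanishes. *)
Lemma spectrum_le_gain j :
  gram_spectrum A 0 j <= M ^+ 2 * (gram_spectrum A 0 j + l) ^+ 2.
Proof.
have := gram_spectrum_ge0 A j; set d := gram_spectrum A 0 j => d_ge0.
have [d0|d_gt0] := leP d 0.
  by apply: (le_trans d0); rewrite mulr_ge0 ?sqr_ge0.
have [i si] := spectrum_singular_value d_gt0.
have : gain i <= M by exact: le_bigmax.
rewrite si sqr_sqrtr// ler_pdivrMr ?addr_gt0// => h.
rewrite -exprMn -{1}(sqr_sqrtr d_ge0) ler_sqr ?nnegrE ?sqrtr_ge0//.
by rewrite mulr_ge0 ?max_gain_ge0// addr_ge0// ltW.
Qed.

Lemma ridge_bound v : l2norm (E *m v) <= M * l2norm v.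
Proof.
apply: l2norm_trmx_bound max_gain_ge0 _ v => w.
have symG : (G + l%:M)^T = G + l%:M.
  by rewrite linearD/= trmx_mul trmxK tr_scalar_mx.
rewrite trmx_mul trmxK trmx_inv symG -mulmxA.
apply: le_trans (l2norm_gram_shift max_gain_ge0 spectrum_le_gain _) _.
by rewrite mulmxA mulmxV ?mul1mx// ridge_gram_unit.
Qed.

(** [E] is evaluated at [A u] for an eigenvector [u] of [G], the right singular
    vector of [A] for the [i]-th singular value. *)
Lemma gain_le_opnorm i : gain i <= opnorm E.
Proof.
have [j si] := singular_value_spectrum A i.
have op v := le_opnorm v ridge_bound max_gain_ge0.
have d_ge0 := gram_spectrum_ge0 A j.
rewrite si sqr_sqrtr//; set d := gram_spectrum A 0 j in d_ge0 *.
have dl_gt0 : 0 < d + l by rewrite ltr_wpDl.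
have [u u0 Gu] := gram_eigenvector A j; rewrite -/d in Gu.
have EAu : E *m (A *m u) = (d / (d + l)) *: u.
  have Glu : (G + l%:M) *m u = (d + l) *: u.
    by rewrite mulmxDl Gu mul_scalar_mx scalerDl.
  rewrite -mulmxA [A^T *m (A *m u)]mulmxA Gu.
  apply: (canLR (mulKmx ridge_gram_unit)).
  by rewrite -scalemxAr Glu scalerA divfK ?gt_eqF.
have := op (A *m u); rewrite EAu l2normZ ger0_norm ?(divr_ge0 _ (ltW _))//.
have -> : l2norm (A *m u) = Num.sqrt d * l2norm u.
  rewrite -[LHS]ger0_norm ?l2norm_ge0// -sqrtr_sqr.
  rewrite (l2norm_gram_eigenvector Gu) sqrtrM//.
  by rewrite sqrtr_sqr ger0_norm ?l2norm_ge0.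
rewrite mulrA ler_pM2r ?l2norm_gt0//.
have [->|s_neq0] := eqVneq (Num.sqrt d) 0; first by rewrite mul0r opnorm_ge0.
have s_gt0 : 0 < Num.sqrt d by rewrite lt_def s_neq0 sqrtr_ge0.
by rewrite -{1}(sqr_sqrtr d_ge0) expr2 -mulrA mulrC ler_pM2r.
Qed.

Lemma opnorm_ridge : opnorm E = M.
Proof.
apply/le_anti/andP; split; first exact: opnorm_le ridge_bound max_gain_ge0.
apply/bigmax_leP; split=> [|j _]; [exact: opnorm_ge0 | exact: gain_le_opnorm].
Qed.

Lemma max_gain_le : M <= 1 / (2 * Num.sqrt l).
Proof.
have s_gt0 : 0 < Num.sqrt l by rewrite sqrtr_gt0.
have sl : Num.sqrt l ^+ 2 = l by rewrite sqr_sqrtr// ltW.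
apply/bigmax_leP; split=> [|i _]; first by rewrite divr_ge0// mulr_ge0// ltW.
set s := singular_value A i.
rewrite ler_pdivlMr ?mulr_gt0// mulrAC ler_pdivrMr ?ltr_wpDl ?sqr_ge0//.
have := sqr_ge0 (s - Num.sqrt l); nra.
Qed.

End Ridge.

(* All terms of the maximum are nonnegative, so the default value 0 of the big
   operator does not affect it. *)
Theorem lemma3p1 (R : realType) (T : Type) (n1 m1 : nat)
    (phi : 'I_m1 -> T -> R) (x : 'I_n1 -> T) (lambda : R)
    (lambda_gt0 : 0 < lambda) :
  let Phi := design_mx phi x in
  [/\ opnorm (encoder_mx phi x lambda) =
        \big[Num.max/0]_(i < minn n1 m1)
          (singular_value Phi i / (singular_value Phi i ^+ 2 + lambda)),
      \big[Num.max/0]_(i < minn n1 m1)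
          (singular_value Phi i / (singular_value Phi i ^+ 2 + lambda))
        <= 1 / (2 * Num.sqrt lambda)
    & forall f g : T -> R,
        l2norm (encoder phi x lambda f - encoder phi x lambda g)
        <= 1 / (2 * Num.sqrt lambda) * l2norm (sample x f - sample x g)].
Proof.
move=> Phi; split; [exact: opnorm_ridge | exact: max_gain_le | move=> f g].
rewrite !encoderE// -mulmxBr.
apply: le_trans (ridge_bound _ lambda_gt0 _) _.
by rewrite ler_wpM2r ?l2norm_ge0// max_gain_le.
Qed.
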